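(* Let $K \geq 1$ be an integer. Let $X$ be uniformly distributed on $[0,1)$, and let $K-1$ thresholds be drawn independently of each other and of $X$, each uniformly distributed on $[0,1)$; denote them in ascending order by $a_1 \leq a_2 \leq \cdots \leq a_{K-1}$, and set $a_0 = 0$, $a_K = 1$. Define the encoder $\alpha:[0,1) \to \{1,2,\ldots,K\}$ by $\alpha(x) = k$ for $x \in [a_{k-1}, a_k)$. Then the expected conditional entropy of the quantizer index given the thresholds, averaged over the thresholds, is $$R = \mathbb{E}\Big[ H\big(\alpha(X) \,\big|\, \{a_k\}_{k=1}^{K-1}\big)\Big] = \frac{1}{\ln 2}\sum_{k=2}^{K} \frac{1}{k}.$$
   Context: For fixed values of the thresholds, $H(\alpha(X) \mid \{a_k\}_{k=1}^{K-1})$ denotes the Shannon entropy in bits of the discrete random variable $\alpha(X)$ (with $X$ uniform on $[0,1)$ and the thresholds held fixed), i.e. $-\sum_{k} p_k \log_2 p_k$ where $p_k = \Pr[\alpha(X)=k]$, with the convention $0\log_2 0 = 0$; the outer expectation averages this quantity over the random thresholds. *)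

(* Defs.v *)
From HB Require Import structures.
From mathcomp Require Import all_boot all_order all_algebra.
From mathcomp Require Import all_classical all_reals all_analysis.
Set Implicit Arguments. Unset Strict Implicit. Unset Printing Implicit Defensive.
Import Order.TTheory GRing.Theory Num.Theory.
Local Open Scope classical_set_scope.
Local Open Scope ring_scope.

Section Defs.
Variable R : realType.

(* Thresholds: u is the list of the K-1 i.i.d. draws; sorted ascending they
   give a_1 <= ... <= a_{K-1}; a_0 = 0 and a_K = 1 (K = size u + 1). *)
Definition thr (u : seq R) (k : nat) : R :=
  if k == 0%N then 0
  else if (k <= size u)%N then nth 0 (sort <=%R u) k.-1 else 1.

Definition alpha_pre (u : seq R) (k : nat) : set R :=
  [set x | (0 <= x < 1) /\ (thr u k.-1 <= x < thr u k)].

(* p_k = Pr[alpha(X) = k] for X uniform on [0,1) (thresholds fixed). *)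
Definition pk (u : seq R) (k : nat) : R :=
  fine ((@lebesgue_measure R) (alpha_pre u k)).

Definition ent_term (p : R) : R := if p == 0 then 0 else - (p * ln p) / ln 2.

Definition entropy_given (u : seq R) : R :=
  \sum_(1 <= k < (size u).+2) ent_term (pk u k).

(* Expectation over n i.i.d. Uniform[0,1) draws of a nonnegative function,
   as the iterated Lebesgue integral (Tonelli). *)
Fixpoint iter_unif_expect (n : nat) (f : seq R -> \bar R) : \bar R :=
  match n with
  | O => f [::]
  | n'.+1 => (\int[@lebesgue_measure R]_(x in `[(0:R)%R, (1:R)%R[) iter_unif_expect n' (fun s => f (x :: s)))%E
  end.

End Defs.

(* Main.v *)
(** A function of the thresholds of the form [sum psi(gap)] keeps this form
    when one uniform threshold is averaged out: since the gaps add up to 1, it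
    becomes [sum T psi(gap)] with [T psi g = (1 - g) psi g + 2 int_0^g psi].
    Starting from [eta g = - g log2 g], one finds
    [T^n eta g = eta g + 1/ln 2 * sum_(2 <= m <= n+1) ((1-g)^m - 1 + m g)/(m(m-1))],
    and with no threshold left there is a single gap [g = 1], where this is
    [1/ln 2 * sum_(2 <= m <= n+1) 1/m]. *)

Require Import Defs.
From HB Require Import structures.
From mathcomp Require Import all_boot all_order all_algebra.
From mathcomp Require Import all_classical all_reals all_analysis.
From mathcomp Require Import measurable_realfun ring lra.
Import Order.TTheory GRing.Theory Num.Theory.
Import numFieldNormedType.Exports.
Local Open Scope ring_scope.

(** * Continuity of [y * ln y] on the whole line *)

Section XlnX.
Local Open Scope classical_set_scope.
Variable R : realType.

(** With [t] the square root of [y], the left side is [2 * t] times [t * ln t^-1], and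
    [ln t^-1 < t^-1]. This bound drives the squeeze at 0 below; for [y <= 0] the convention
    [ln y = 0] applies. *)
Lemma abs_mul_ln_le_sqrt (y : R) : y < 1 -> `|y * ln y| <= 2 * Num.sqrt y.
Proof.
move=> y1; have [y0|y0] := leP y 0.
  by rewrite ln0// mulr0 normr0 mulr_ge0 ?sqrtr_ge0.
set t := Num.sqrt y; have t0 : 0 < t by rewrite sqrtr_gt0.
have yE : y = t ^+ 2 by rewrite sqr_sqrtr// ltW.
have ln_y : ln y = 2 * ln t by rewrite yE lnXn// mulr2n; ring.
have y_ln_le0 : y * ln y <= 0 by rewrite mulr_ge0_le0 ?ln_le0// ltW.
have tVlt : ln t^-1 < t^-1 by rewrite ln_sublinear// invr_gt0.
have : t * ln t^-1 < 1 by rewrite -(divff (lt0r_neq0 t0)) ltr_pM2l.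
rewrite lnV ?posrE// => tln.
rewrite ler0_norm// ln_y yE; nra.
Qed.

Lemma continuous_mul_ln : continuous (fun y : R => y * ln y).
Proof.
move=> x; have [x0|x0|->] := ltgtP x 0.
- apply: (@near_cst_continuous _ _ 0); near=> y.
  rewrite ln0 ?mulr0//; apply/ltW; near: y; exact: lt_nbhsl.
- by apply: cvgM; [exact: cvg_id|exact: continuous_ln].
- rewrite /prop_for/= /continuous_at mul0r; apply: norm_cvg0.
  apply: (@squeeze_cvgr _ _ _ _ (fun=> 0) (fun y : R => 2 * Num.sqrt y)).
  + near=> y; rewrite normr_ge0/= abs_mul_ln_le_sqrt//.
    near: y; exact: lt_nbhsl.
  + exact: cvg_cst.
  + rewrite -[X in _ --> X](mulr0 2) -[X in _ * X]sqrtr0.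
    by apply: cvgMr; exact: sqrt_continuous.
Unshelve. all: by end_near. Qed.

End XlnX.

(** * Averaging a sum over gaps when one threshold is inserted *)

Section GapSum.
Set Implicit Arguments.
Unset Strict Implicit.
Local Open Scope classical_set_scope.
Variable R : realType.
Implicit Types (psi Psi : R -> R) (a b x : R) (s : seq R).
Local Notation mu := (@lebesgue_measure R).

Fixpoint gap_sum psi a s : R :=
  if s is b :: s' then psi (b - a) + gap_sum psi b s' else psi (1 - a).

(** Encoded with [merge] so that it unfolds by the test [x <= b] and inherits sortedness and
    permutation facts. *)
Definition insert x s := merge <=%R [:: x] s.

Lemma gap_sumD psi1 psi2 a s :
  gap_sum (fun g => psi1 g + psi2 g) a s = gap_sum psi1 a s + gap_sum psi2 a s.
Proof. by elim: s a => //= b s IH a; rewrite IH; ring. Qed.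

Lemma eq_gap_sum psi1 psi2 a s : psi1 =1 psi2 ->
  gap_sum psi1 a s = gap_sum psi2 a s.
Proof. by move=> e; elim: s a => //= b s IH a; rewrite e IH. Qed.

(** [Psi 0 = 0] makes [Psi g] the integral of [psi] from 0 to [g]. The derivative is asked only for
    [0 < x]: gaps have nonnegative length, and the primitive used for [ent_term] has the wrong
    derivative at negative points. *)
Definition is_antiderivative psi Psi :=
  [/\ continuous psi, continuous Psi, Psi 0 = 0 &
      forall x, 0 < x -> is_derive x 1 Psi (psi x)].

(** A threshold [x] in the gap from [a] to [b] cuts it into [x - a] and [b - x], and by reflection
    each piece contributes [Psi (b - a)]. The constant [C] carries the gaps that [x] leaves
    intact. *)
Lemma integral_split_gap psi Psi (C a b : R) (b0 b1 : bool) :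
  is_antiderivative psi Psi -> a <= b ->
  measurable_fun ([set` Interval (BSide b0 a) (BSide b1 b)] : set R)
    ((fun x => (psi (x - a) + psi (b - x) + C)%:E) : R -> \bar R) /\
  (\int[mu]_(x in [set` Interval (BSide b0 a) (BSide b1 b)])
     (psi (x - a) + psi (b - x) + C)%:E = (2 * Psi (b - a) + C * (b - a))%:E)%E.
Proof.
move=> [cpsi cPsi Psi0 dPsi] ab.
have cf : continuous (fun x => psi (x - a) + psi (b - x) + C).
  move=> x; apply: cvgD; last exact: cvg_cst.
  apply: cvgD.
    by apply: (@continuous_comp _ _ _ (fun x => x - a) psi); [
      apply: cvgB; [exact: cvg_id|exact: cvg_cst] | exact: cpsi].
  by apply: (@continuous_comp _ _ _ (fun x => b - x) psi); [
    apply: cvgB; [exact: cvg_cst|exact: cvg_id] | exact: cpsi].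
have mf D : measurable D ->
    measurable_fun D ((fun x => (psi (x - a) + psi (b - x) + C)%:E) : R -> \bar R).
  move=> mD; apply: measurableT_comp => //.
  exact: measurable_funS (@subsetT _ D) (continuous_measurable_fun cf).
split; first exact: mf.
move: ab; rewrite le_eqVlt => /predU1P[ab|ab].
  subst b; rewrite integral_itv_bndoo; last exact: mf.
  by rewrite set_itvE integral_set0 subrr Psi0 !mulr0 addr0.
(* Endpoints are null: pass to the open interval, then to the closed one that the fundamental
   theorem of calculus expects. *)
rewrite integral_itv_bndoo; last exact: mf.
rewrite -(@integral_itv_bndoo _ _ _ _ true false); last exact: mf.
pose F x := Psi (x - a) - Psi (b - x) + C * x.
have cF : continuous F.
  move=> x; apply: cvgD; last by apply: cvgMr; exact: cvg_id.
  apply: cvgB.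
    by apply: (@continuous_comp _ _ _ (fun x => x - a) Psi); [
      apply: cvgB; [exact: cvg_id|exact: cvg_cst] | exact: cPsi].
  by apply: (@continuous_comp _ _ _ (fun x => b - x) Psi); [
    apply: cvgB; [exact: cvg_cst|exact: cvg_id] | exact: cPsi].
have dF x : a < x < b -> is_derive x 1 F (psi (x - a) + psi (b - x) + C).
  move=> /andP[ax xb].
  have d1 : is_derive (x - a) 1 Psi (psi (x - a)) by apply: dPsi; lra.
  have d2 : is_derive (b - x) 1 Psi (psi (b - x)) by apply: dPsi; lra.
  have h1 : is_derive x 1 (fun x => x - a) 1.
    by apply: is_derive_eq; rewrite subr0.
  have h2 : is_derive x 1 (fun x => b - x) (- 1).
    by apply: is_derive_eq; rewrite add0r mul1r.
  have c1 := @is_derive1_comp _ Psi (fun x => x - a) x _ _ d1 h1.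
  have c2 := @is_derive1_comp _ Psi (fun x => b - x) x _ _ d2 h2.
  have c3 : is_derive x 1 (fun x => C * x) C.
    by apply: is_derive_eq; rewrite /GRing.scale/=; ring.
  by apply: (is_derive_eq (is_deriveD (is_deriveB c1 c2) c3)); ring.
rewrite (@continuous_FTC2 _ _ F)//.
- by rewrite -EFinB /F !subrr Psi0; congr (_%:E); ring.
- exact: continuous_subspaceT.
- split.
  + by move=> x; rewrite in_itv/= => /dF h; exact: ex_derive.
  + exact/cvg_at_right_filter/cF.
  + exact/cvg_at_left_filter/cF.
- move=> x; rewrite in_itv/= => /dF h.
  by rewrite derive1E derive_val.
Qed.

(** A gap of length [g] loses [psi g] while [x] runs through it, and yields [2 * Psi g] instead. The
    induction cuts the range of [x] at the first threshold [b]; beyond [b] the first gap is intact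
    and is absorbed into [C], which is why [C] is general. *)
Lemma integral_gap_sum_insert psi Psi (C a : R) s :
  is_antiderivative psi Psi -> path <=%R a s -> all (< 1) (a :: s) ->
  measurable_fun (`]a, 1%R[ : set R)
    ((fun x => (C + gap_sum psi a (insert x s))%:E) : R -> \bar R) /\
  (\int[mu]_(x in `]a, 1%R[) (C + gap_sum psi a (insert x s))%:E =
   ((1 - a) * (C + gap_sum psi a s) +
    gap_sum (fun g => 2 * Psi g - g * psi g) a s)%:E)%E.
Proof.
move=> psiP; elim: s C a => [|b s IH] C a /=.
  move=> _ /andP[a1 _].
  have [m1 i1] := @integral_split_gap psi Psi C a 1 false true psiP (ltW a1).
  split.
    by apply: eq_measurable_fun m1 => x _; congr (_%:E); ring.
  rewrite [LHS](_ : _ = \int[mu]_(x in `]a, 1%R[)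
      (psi (x - a) + psi (1 - x) + C)%:E)%E.
    by rewrite i1; congr (_%:E); ring.
  by apply: eq_integral => x _; congr (_%:E); ring.
move=> /andP[ab pbs] /and3P[a1 b1 s1].
have [m1 i1] :=
  @integral_split_gap psi Psi (C + gap_sum psi b s) a b false false psiP ab.
have [m2 i2] : measurable_fun (`]b, 1%R[ : set R) _ /\ _ :=
  IH (C + psi (b - a)) b pbs (introT andP (conj b1 s1)).
(* The tie [x = b] belongs to the left piece, since [insert] tests [x <= b]. *)
have e1 x : x \in `]a, b] ->
    (psi (x - a) + psi (b - x) + (C + gap_sum psi b s))%:E =
    (C + gap_sum psi a (insert x (b :: s)))%:E.
  by rewrite inE/= in_itv/= /insert/= => /andP[_ ->] /=; congr (_%:E); ring.
have e2 x : x \in `]b, 1%R[ ->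
    (C + psi (b - a) + gap_sum psi b (insert x s))%:E =
    (C + gap_sum psi a (insert x (b :: s)))%:E.
  by rewrite inE/= in_itv/= ltNge /insert/= => /andP[/negbTE -> _] /=; rewrite addrA.
have m1' := eq_measurable_fun _ e1 m1.
have m2' := eq_measurable_fun _ e2 m2.
have U : `]a, 1%R[ = (`]a, b] `|` `]b, 1%R[) :> set R.
  by rewrite -itv_bndbnd_setU// bnd_simp// ltW.
have mU : measurable_fun (`]a, 1%R[ : set R)
    ((fun x => (C + gap_sum psi a (insert x (b :: s)))%:E) : R -> \bar R).
  by rewrite U; apply/measurable_funU.
split=> //.
rewrite [in LHS]U integral_setU//; last 2 first.
- by rewrite -U.
- apply/disj_setPS => x [] /=; rewrite !in_itv/= => /andP[_ xb] /andP[bx _].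
  by move: (lt_le_trans bx xb); rewrite ltxx.
under eq_integral do rewrite -e1//.
under [X in (_ + X)%E]eq_integral do rewrite -e2//.
by rewrite i1 i2 -EFinD; congr (_%:E); ring.
Qed.

End GapSum.

(** * Iterates of the averaging operator on the entropy term *)

Section GapEntropy.
Set Implicit Arguments.
Unset Strict Implicit.
Variable R : realType.
Local Open Scope classical_set_scope.
Implicit Types psi Psi : R -> R.

Lemma is_antiderivativeD psi1 Psi1 psi2 Psi2 :
  is_antiderivative psi1 Psi1 -> is_antiderivative psi2 Psi2 ->
  is_antiderivative (fun g : R => psi1 g + psi2 g) (fun g => Psi1 g + Psi2 g).
Proof.
move=> [c1 C1 z1 d1] [c2 C2 z2 d2]; split.
- by move=> x; apply: cvgD; [exact: c1|exact: c2].
- by move=> x; apply: cvgD; [exact: C1|exact: C2].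
- by rewrite z1 z2 addr0.
- move=> x x0; have h1 := d1 x x0; have h2 := d2 x x0.
  exact: (is_deriveD h1 h2).
Qed.

Lemma is_antiderivativeM (c : R) psi Psi : is_antiderivative psi Psi ->
  is_antiderivative (fun g : R => psi g * c) (fun g => Psi g * c).
Proof.
move=> [c1 C1 z1 d1]; split.
- by move=> x; apply: cvgMl; exact: c1.
- by move=> x; apply: cvgMl; exact: C1.
- by rewrite z1 mul0r.
- move=> x x0; have h1 := d1 x x0.
  by apply: is_derive_eq; rewrite scaler0 add0r /GRing.scale/= mulrC.
Qed.

Lemma ent_termE (p : R) : ent_term p = - (p * ln p) / ln 2.
Proof. by rewrite /ent_term; case: eqP => // ->; rewrite mul0r oppr0 mul0r. Qed.

(** Integration by parts; the grouping [g * (g * ln g)] lets continuity at 0 follow from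
    [continuous_mul_ln]. *)
Lemma ent_term_antiderivative : is_antiderivative (@ent_term R)
  (fun g => (g ^+ 2 / 4 - g * (g * ln g) / 2) / ln 2).
Proof.
rewrite (_ : @ent_term R = fun p => - (p * ln p) / ln 2); last first.
  by apply/funext => p; exact: ent_termE.
apply: (@is_antiderivativeM _ (fun p => - (p * ln p))
  (fun g => g ^+ 2 / 4 - g * (g * ln g) / 2)).
split.
- by move=> x; apply: cvgN; exact: continuous_mul_ln.
- move=> x; apply: cvgB; apply: cvgMl; first exact: exprn_continuous.
  by apply: cvgM; [exact: cvg_id|exact: continuous_mul_ln].
- by rewrite expr0n/= !mul0r subr0.
- move=> x x0; have dln := is_derive1_ln x0.
  apply: is_derive_eq; rewrite /GRing.scale/=.
  by field; rewrite gt_eqF.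
Qed.

(** The excess in Bernoulli's inequality for the power [m] of [1 - g]. *)
Definition bernoulli_gap m (g : R) : R := (1 - g) ^+ m - 1 + m%:R * g.

Definition bernoulli_gap_prim m (g : R) : R :=
  (1 - (1 - g) ^+ m.+1) / m.+1%:R - g + m%:R * g ^+ 2 / 2.

Lemma bernoulli_gap_antiderivative m :
  is_antiderivative (bernoulli_gap m) (bernoulli_gap_prim m).
Proof.
have cX k : continuous (fun g : R => (1 - g) ^+ k).
  move=> x; apply: (@continuous_comp _ _ _ (fun x : R => 1 - x) (fun y => y ^+ k)).
    by apply: cvgB; [exact: cvg_cst|exact: cvg_id].
  exact: exprn_continuous.
split.
- move=> x; apply: cvgD; last by apply: cvgMr; exact: cvg_id.
  by apply: cvgB; [exact: cX|exact: cvg_cst].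
- move=> x; apply: cvgD.
    apply: cvgB; last exact: cvg_id.
    by apply: cvgMl; apply: cvgB; [exact: cvg_cst|exact: cX].
  by apply: cvgMl; apply: cvgMr; exact: exprn_continuous.
- by rewrite /bernoulli_gap_prim !subr0 expr1n subrr expr0n/= !(mul0r, mulr0) addr0.
- move=> x _.
  have d1 : is_derive x 1 (fun g : R => 1 - g) (- 1).
    by apply: is_derive_eq; rewrite add0r mul1r.
  have dX : is_derive x 1 (fun g : R => (1 - g) ^+ m.+1)
      (- (m.+1%:R * (1 - x) ^+ m)).
    rewrite (_ : (fun g => _) = (fun g : R => 1 - g) ^+ m.+1).
      by apply: (is_derive_eq (is_deriveX m.+1 d1)); rewrite /GRing.scale/= mulrN1.
    by apply/funext => g; rewrite exprfctE.
  have d2 : is_derive x 1 (fun g : R => m%:R * g ^+ 2 / 2 - g) (m%:R * x - 1).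
    by apply: is_derive_eq; rewrite /GRing.scale/=; field.
  have d3 := is_deriveB d2 (is_deriveZ (m.+1%:R)^-1 dX).
  rewrite (_ : bernoulli_gap_prim m = fun g : R =>
    (m%:R * g ^+ 2 / 2 - g - m.+1%:R^-1 *: (1 - g) ^+ m.+1) + m.+1%:R^-1).
    have d4 : is_derive x 1 (fun g : R => (m%:R * g ^+ 2 / 2 - g
        - m.+1%:R^-1 *: (1 - g) ^+ m.+1) + m.+1%:R^-1) _ :=
      is_deriveD d3 (is_derive_cst (m.+1%:R^-1 : R) x 1).
    apply: (is_derive_eq d4).
    rewrite /bernoulli_gap /GRing.scale/=.
    by field; rewrite ?natr1 ?nat1r pnatr_eq0.
  apply/funext => g; rewrite /bernoulli_gap_prim /GRing.scale/=.
  by field; rewrite ?natr1 ?nat1r pnatr_eq0.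
Qed.

(** Averaging sends [bernoulli_gap m] to [(m - 1) / (m + 1)] times [bernoulli_gap m.+1]; dividing by
    [m * (m - 1)] turns this into a pure shift of [m]. *)
Lemma bernoulli_gap_step m (g : R) : (1 < m)%N ->
  bernoulli_gap m.+1 g / (m.+1%:R * m%:R) =
  ((1 - g) * bernoulli_gap m g + 2 * bernoulli_gap_prim m g) / (m%:R * m.-1%:R).
Proof.
case: m => [|[|m]]// _; rewrite /bernoulli_gap /bernoulli_gap_prim /=.
rewrite !exprS -!natr1; field.
by rewrite !natr1 !pnatr_eq0.
Qed.

(* [T^n eta], the expected entropy contributed by a gap of length [g] when [n]
   further thresholds are drawn in [0, 1). *)
Fixpoint gap_entropy n (g : R) : R :=
  if n is n'.+1 then
    gap_entropy n' g + bernoulli_gap n.+1 g * (n.+1%:R * n%:R * ln 2)^-1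
  else ent_term g.

Fixpoint gap_entropy_prim n (g : R) : R :=
  if n is n'.+1 then
    gap_entropy_prim n' g + bernoulli_gap_prim n.+1 g * (n.+1%:R * n%:R * ln 2)^-1
  else (g ^+ 2 / 4 - g * (g * ln g) / 2) / ln 2.

Lemma gap_entropy_antiderivative n :
  is_antiderivative (gap_entropy n) (gap_entropy_prim n).
Proof.
elim: n => [|n IH]; first exact: ent_term_antiderivative.
apply: (is_antiderivativeD IH); apply: is_antiderivativeM.
exact: bernoulli_gap_antiderivative.
Qed.

(** Links the closed form to the operator. The base case adds the term [g ^+ 2 / (2 * ln 2)];
    afterwards, by linearity, the operator shifts the last increment to the next one. *)
Lemma gap_entropyS n (g : R) :
  gap_entropy n.+1 g = (1 - g) * gap_entropy n g + 2 * gap_entropy_prim n g.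
Proof.
elim: n => [|n IH].
  have ln2 : ln (2 : R) != 0 by rewrite gt_eqF// ln_gt0// ltr1n.
  by rewrite /= ent_termE /bernoulli_gap; field.
have step := @bernoulli_gap_step n.+2 g isT.
have unfoldS k : gap_entropy k.+1 g =
  gap_entropy k g + bernoulli_gap k.+2 g / (k.+2%:R * k.+1%:R) / ln 2.
  by rewrite /= invfM mulrA.
rewrite unfoldS step [X in X + _ = _]IH unfoldS /= !invfM; ring.
Qed.

(** At [g = 1] the entropy term vanishes and [bernoulli_gap m 1 = m - 1], so each increment reduces
    to [1 / m] over [ln 2]. *)
Lemma gap_entropy1 n :
  gap_entropy n 1 = (\sum_(2 <= k < n.+2) (k%:R)^-1) / ln 2.
Proof.
elim: n => [|n IH].
  by rewrite /= big_geq// ent_termE ln1 mulr0 oppr0 mul0r.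
rewrite /= IH [in RHS]big_nat_recr//= [RHS]mulrDl; congr (_ + _).
rewrite /bernoulli_gap subrr expr0n/= !invfM mulr1 -!natr1 !mulrA; congr (_ * _).
by field; rewrite !natr1 !pnatr_eq0.
Qed.

End GapEntropy.

(** * From the iterated integral and the quantizer to gap sums *)

Section Expectation.
Set Implicit Arguments.
Unset Strict Implicit.
Variable R : realType.
Local Open Scope classical_set_scope.
Local Notation mu := (@lebesgue_measure R).
Implicit Types (u s : seq R).

Lemma eq_iter_unif_expect n (f g : seq R -> \bar R) :
  (forall u, all (fun x => 0 <= x < 1) u -> f u = g u) ->
  iter_unif_expect n f = iter_unif_expect n g.
Proof.
elim: n f g => [|n IH] f g fg /=; first exact: fg.
apply: eq_integral => x; rewrite inE/= in_itv/= => x01.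
by apply: IH => u u01; apply: fg; rewrite /= x01.
Qed.

Lemma sort_rcons_insert s (x : R) :
  sort <=%R (rcons s x) = insert x (sort <=%R s).
Proof.
apply: le_sorted_eq; first exact: sort_le_sorted.
  by apply: merge_sorted; [exact: le_total| |exact: sort_le_sorted].
rewrite perm_sort perm_sym perm_merge/= -cats1 perm_sym perm_catC /=.
by rewrite perm_cons perm_sym perm_sort.
Qed.

Lemma sort01 s : all (fun x => 0 <= x < 1) s ->
  path <=%R 0 (sort <=%R s) /\ all (< 1) (0 :: sort <=%R s).
Proof.
move=> s01; split.
  rewrite path_min_sorted ?sort_le_sorted// all_sort.
  by apply: sub_all s01 => x /andP[].
by rewrite /= ltr01 all_sort; apply: sub_all s01 => x /andP[].
Qed.

Lemma integral_gap_entropy n s : all (fun x => 0 <= x < 1) s ->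
  (\int[mu]_(x in `[(0:R)%R, (1:R)%R[)
     (gap_sum (gap_entropy n) 0 (sort <=%R (rcons s x)))%:E =
   (gap_sum (gap_entropy n.+1) 0 (sort <=%R s))%:E)%E.
Proof.
move=> /sort01[ps s1].
have [m i] := @integral_gap_sum_insert _ _ _ 0 _ _
  (gap_entropy_antiderivative R n) ps s1.
under eq_integral do rewrite sort_rcons_insert -[gap_sum _ _ _]add0r.
rewrite integral_itv_bndoo// i add0r subr0 mul1r -gap_sumD.
congr (_%:E); apply: eq_gap_sum => g; rewrite gap_entropyS; ring.
Qed.

(** The list [s] holds the draws fixed by the outer integrals. The inner draws are averaged first,
    by induction at [rcons s x]; the integral over [x] then applies the operator once more. *)
Lemma iter_gap_entropy n m s : all (fun x => 0 <= x < 1) s ->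
  iter_unif_expect n
    (fun u => (gap_sum (gap_entropy m) 0 (sort <=%R (s ++ u)))%:E) =
  (gap_sum (gap_entropy (n + m)) 0 (sort <=%R s))%:E.
Proof.
elim: n s => [|n IH] s s01 /=; first by rewrite cats0.
rewrite -integral_gap_entropy//; apply: eq_integral => x.
rewrite inE/= in_itv/= => x01; rewrite -IH ?all_rcons ?x01//.
by congr iter_unif_expect; apply/funext => u; rewrite cat_rcons.
Qed.

(** The default value 1 of [nth] supplies the right end of the last gap. *)
Lemma gap_sumE (psi : R -> R) a s : gap_sum psi a s =
  \sum_(0 <= k < (size s).+1) psi (nth 1 s k - nth 1 (a :: s) k).
Proof.
elim: s a => [|b s IH] a /=; first by rewrite big_nat1.
by rewrite big_nat_recl//= IH.
Qed.

Lemma nth_path_le a s k : path <=%R a s -> all (< 1) (a :: s) ->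
  [/\ a <= nth 1 (a :: s) k, nth 1 (a :: s) k <= nth 1 s k & nth 1 s k <= 1].
Proof.
elim: s a k => [|b s IH] a [|k] /=.
- by move=> _ /andP[/ltW ->].
- by rewrite !nth_nil => _ /andP[/ltW ->].
- by move=> /andP[-> _] /and3P[_ /ltW -> _].
- move=> /andP[ab pbs] /andP[_ bs1]; have [h1 h2 h3] := IH b k pbs bs1.
  by rewrite (le_trans ab h1).
Qed.

Lemma pkE u k : all (fun x => 0 <= x < 1) u -> (k <= size u)%N ->
  pk u k.+1 = nth 1 (sort <=%R u) k - nth 1 (0 :: sort <=%R u) k.
Proof.
move=> /sort01[p u1] ku.
have [ge0 le le1] := nth_path_le k p u1.
(* Prepending 0 accounts for the threshold of index 0, and the default 1 for the one of index
   [(size u).+1]. *)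
have thrE j : (j <= (size u).+1)%N -> thr u j = nth 1 (0 :: sort <=%R u) j.
  case: j => // j ju; rewrite /thr/=; case: ifPn => ju'.
    by apply: set_nth_default; rewrite size_sort.
  by rewrite nth_default// size_sort leqNgt.
rewrite /pk /alpha_pre !thrE//; last exact: leqW.
set l := nth 1 (0 :: _) k; rewrite -/l in ge0 le; set r := nth _ _ _ in le le1 *.
rewrite (_ : [set x | _] = `[l, r[%classic); last first.
  apply/seteqP; split => x /=; rewrite in_itv/=; first by case.
  move=> lr; split => //; case/andP: lr => lx xr.
  by rewrite (le_trans ge0 lx) (lt_le_trans xr le1).
(* When thresholds coincide the cell is empty, and the difference is 0 as well. *)
rewrite lebesgue_measure_itv/= lte_fin; case: ltP => //= rl.
by apply/eqP; rewrite eq_sym subr_eq0 eq_le rl le.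
Qed.

Lemma entropy_given_gap_sum u : all (fun x => 0 <= x < 1) u ->
  entropy_given u = gap_sum (gap_entropy 0) 0 (sort <=%R u).
Proof.
move=> u01; rewrite gap_sumE size_sort /entropy_given big_add1/=.
by rewrite big_nat [RHS]big_nat; apply: eq_bigr => k ku; rewrite pkE.
Qed.

End Expectation.

Theorem theorem2 (R : realType) (K : nat) (hK : (1 <= K)%N) :
  iter_unif_expect K.-1 (fun u : seq R => (entropy_given u)%:E) =
  ((\sum_(2 <= k < K.+1) (k%:R : R)^-1) / ln (2 : R))%:E.
Proof.
(* With the empty list of fixed draws, [iter_gap_entropy] leaves the single gap from 0 to 1. *)
rewrite (@eq_iter_unif_expect _ _ _
  (fun u => (gap_sum (gap_entropy 0) 0 (sort <=%R ([::] ++ u)))%:E)); last first.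
  by move=> u /entropy_given_gap_sum ->.
by rewrite iter_gap_entropy// addn0 /= subr0 gap_entropy1 prednK.
Qed.
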